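(* Let $(\Omega,\mathcal F)$ be a measurable space and let $\mathcal P,\mathcal Q\subseteq\mathcal M_1$ be arbitrary nonempty sets of probability measures. Then $$\sup_{X\in\mathcal E_b}\ \inf_{\mathsf Q\in\mathcal Q}\mathbb E_{\mathsf Q}[\log X]\;=\;\min_{\nu\in\overline{\mathrm{co}}^*(\mathcal Q)}\ \min_{\mu\in\overline{\mathrm{co}}^*(\mathcal P)}H(\nu\mid\mu),$$ even if one side, and then also the other side, equals infinity. Further, there exists a pair $(\mu^*,\nu^* )\in\overline{\mathrm{co}}^*(\mathcal P)\times\overline{\mathrm{co}}^*(\mathcal Q)$ that achieves the minimum on the right-hand side.
   Context: $\mathcal M_1$ is the set of (countably additive) probability measures on $\mathcal F$. An e-variable for $\mathcal P$ is a measurable $X:\Omega\to[0,\infty]$ with $\int X\,d\mathsf P\le1$ for all $\mathsf P\in\mathcal P$; $\mathcal E_b$ is the set of e-variables that are bounded from above, $\sup_\omega X(\omega)<\infty$. Conventions: $\log0=-\infty$; $\mathbb E_{\mathsf Q}[\log X]=\mathbb E_{\mathsf Q}[(\log X)^+]-\mathbb E_{\mathsf Q}[(\log X)^-]$ if $\mathbb E_{\mathsf Q}[(\log X)^-]<\infty$, and $\mathbb E_{\mathsf Q}[\log X]=-\infty$ if $\mathbb E_{\mathsf Q}[(\log X)^-]=\infty$. $\mathcal B_b$ is the Banach space of bounded measurable functions $\Omega\to\mathbb R$ with the supremum norm. $\mathrm{ba}$ is the space of bounded finitely additive signed measures on $(\Omega,\mathcal F)$, $\mathrm{ba}_+$ its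 positive cone, and $\mathrm{ba}_1=\{\mu\in\mathrm{ba}_+:\mu(\Omega)=1\}$. For $\mathcal A\subseteq\mathrm{ba}$, $\overline{\mathrm{co}}^*(\mathcal A)$ is the closure of the convex hull of $\mathcal A$ in $\mathrm{ba}$ for the weak-$*$ topology $\sigma(\mathrm{ba},\mathcal B_b)$ (elements of $\mathcal B_b$ act on $\mathrm{ba}$ by finitely additive integration). Relative entropy: for $\nu\in\mathrm{ba}_1$, $\mu\in\mathrm{ba}_+$ and a finite measurable partition $\pi=\{A_1,\dots,A_n\}$ of $\Omega$, $H_\pi(\nu\mid\mu)=\sum_{i=1}^n\nu(A_i)\log\frac{\nu(A_i)}{\mu(A_i)}$, where $q\log(q/p)=0$ if $q=0$ and $=\infty$ if $p=0<q$; $H(\nu\mid\mu)=\sup_\pi H_\pi(\nu\mid\mu)$ over all finite measurable partitions. *)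

(* Defs.v *)
From HB Require Import structures.
From mathcomp Require Import all_boot all_order all_algebra.
From mathcomp Require Import all_classical all_reals all_analysis.
From mathcomp Require Import measurable_realfun.

Set Implicit Arguments.
Unset Strict Implicit.
Unset Printing Implicit Defensive.

Import Order.TTheory GRing.Theory Num.Theory.
Import numFieldNormedType.Exports.
Import HBSimple.

Local Open Scope classical_set_scope.
Local Open Scope ring_scope.

Section BoundedCharges.
Context {d : measure_display} {T : measurableType d} {R : realType}.

(* A set function on the sigma-algebra is represented by its extension by 0
   to all subsets of T, so that equality of such functions is equality of
   charges. *)
Definition ba_spec (m : set T -> R^o) : Prop :=
  [/\ forall A, ~ measurable A -> m A = 0,
      forall A B, measurable A -> measurable B -> A `&` B = set0 ->
        m (A `|` B) = m A + m B
    & exists M : R, forall A, measurable A -> `|m A| <= M].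

Definition ba_pred : {pred (set T -> R^o)} := mem [set m | ba_spec m].

Lemma ba_pred_submod_closed : submod_closed ba_pred.
Proof.
split=> [|a u v].
  apply/mem_set; split=> // [A B _ _ _|]; first by rewrite addr0.
  by exists 0 => A _; rewrite normr0.
move=> /set_mem[u0 uD [Mu uM]] /set_mem[v0 vD [Mv vM]]; apply/mem_set; split.
- move=> A nA; rewrite -[LHS]/(a * u A + v A).
  by rewrite u0// v0// mulr0 addr0.
- move=> A B mA mB AB.
  by rewrite -[LHS]/(a * u (A `|` B) + v (A `|` B)) uD// vD// mulrDr addrACA.
- exists (`|a| * Mu + Mv) => A mA; rewrite -[(_ + _) A]/(a * u A + v A).
  by rewrite (le_trans (ler_normD _ _))// normrM lerD ?ler_wpM2l ?uM ?vM.
Qed.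

HB.instance Definition _ :=
  GRing.isSubmodClosed.Build R (set T -> R^o) ba_pred ba_pred_submod_closed.

Record ba : Type := BoundedCharge {
  ba_val :> set T -> R^o ;
  ba_valP : ba_val \in ba_pred }.

HB.instance Definition _ := [isSub for ba_val].
HB.instance Definition _ := [Choice of ba by <:].
HB.instance Definition _ := [SubChoice_isSubLmodule of ba by <:].

End BoundedCharges.
Arguments ba {d} T R.

Section Definitions.
Context {d : measure_display} {T : measurableType d} {R : realType}.
Implicit Types (mu nu : ba T R) (P Q : probability T R).
Implicit Types (PP QQ : set (probability T R)).

Definition prob_fun P (A : set T) : R^o :=
  if `[< measurable A >] then fine (P A) else 0.

Lemma prob_fun_ba P : prob_fun P \in ba_pred.
Proof.
apply/mem_set; split.
- by move=> A nA; rewrite /prob_fun; case: asboolP.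
- move=> A B mA mB AB; rewrite /prob_fun !asboolT//; last exact: measurableU.
  by rewrite measureU// fineD ?fin_num_measure.
- exists 1 => A mA; rewrite /prob_fun asboolT// ger0_norm ?fine_ge0//.
  by rewrite -lee_fin fineK ?fin_num_measure ?probability_le1.
Qed.

Definition prob_ba P : ba T R := BoundedCharge (prob_fun_ba P).

Definition Bb := {f : {mfun T >-> R} | [bounded f x | x in [set: T]]}.

HB.instance Definition _ := gen_eqMixin Bb.
HB.instance Definition _ := gen_choiceMixin Bb.

(* Integral of a bounded measurable function against a bounded finitely
   additive signed measure: the limit of the integrals of the simple
   functions converging uniformly to f. *)
Definition ba_int mu (f : Bb) : R :=
  get [set l : R | forall e : R, 0 < e -> exists2 r : R, 0 < r &
    forall s : {sfun T >-> R}, (forall x, `|sval f x - s x| <= r) ->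
      `|l - fine (sintegral (fun A => (mu A)%:E) s)| <= e].

(* ba with the topology sigma(ba, B_b): the coarsest one for which all the
   maps mu |-> ba_int mu f are continuous. *)
Definition wstar_ba : topologicalType :=
  initial_topology (ba_int : ba T R -> {ptws Bb -> R}).

Definition co (A : set (ba T R)) : set (ba T R) :=
  smallest (@convex_set R (ba T R)) A.

Definition wstar_cco (A : set (ba T R)) : set (ba T R) :=
  @closure wstar_ba (co A).

Definition entropy_term (q p : R) : \bar R :=
  if q == 0 then 0%E else if p == 0 then +oo%E else (q * ln (q / p))%:E.

Definition partition_entropy nu mu n (A : 'I_n -> set T) : \bar R :=
  (\sum_(i < n) entropy_term (nu (A i)) (mu (A i)))%E.

(* Only meaningful for nu in ba_1 and mu in ba_+; both hold on the weak-*
   closed convex hull of a set of probability measures. *)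
Definition relative_entropy nu mu : \bar R :=
  ereal_sup [set h | exists n (A : 'I_n -> set T),
    [/\ forall i, measurable (A i), partition [set: 'I_n] A [set: T]
      & h = partition_entropy nu mu A]].

Definition evariable PP (X : T -> \bar R) : Prop :=
  [/\ measurable_fun [set: T] X, forall x, (0 <= X x)%E
    & forall P, PP P -> (\int[P]_x X x <= 1)%E].

Definition bounded_evariable PP : set (T -> \bar R) :=
  [set X | evariable PP X /\ (ereal_sup (range X) < +oo)%E].

Definition expected_log Q (X : T -> \bar R) : \bar R :=
  let L := fun x => lne (X x) in
  if (\int[Q]_x (L^\-)%E x < +oo)%E
  then (\int[Q]_x (L^\+)%E x - \int[Q]_x (L^\-)%E x)%E
  else -oo%E.

End Definitions.

Definition attains_inf (R : realType) (S : set (\bar R)) : Prop :=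
  S (ereal_inf S).

(* Main.v *)
Require Import Defs.
From HB Require Import structures.
From mathcomp Require Import all_boot all_order all_algebra finmap.
From mathcomp Require Import all_classical all_reals all_analysis.
From mathcomp Require Import measurable_realfun ring lra.

(** The theorem is a minimax identity in disguise. For finitely additive
    probabilities nu and mu, the Donsker-Varadhan formula in its
    unnormalised form reads

      H(nu | mu) = sup_f (nu(f) - mu(e^f) + 1),

    where f ranges over the measurable functions with finitely many values.
    The bound >= is the pointwise Young inequality
    a q - e^a p + q <= q log (q / p), summed over the cells of a partition on
    which f is constant; it is sharp with a = log (q / p), up to a limit when p
    or q vanishes ([donsker_varadhan_le], [donsker_varadhan_approx]). For
    fixed f the right-hand side is affine and weak-* continuous in (nu, mu);
    for fixed (nu, mu) it is concave in f.

    Hence H is a supremum of weak-* continuous functions. The weak-* closed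
    convex hulls of the two sets of probabilities are compact
    ([wstar_cco_compact]), so that all the minima are attained
    ([compact_attains_inf]).

    For the inequality <=, let X be a bounded e-variable and e > 0. Some step
    function f satisfies X < e^f <= X + e. For it, the infimum of E_Q[log X]
    over Q is at most nu(f), and mu(e^f) <= 1 + e, because closed half-spaces
    pass from a set of probabilities to its weak-* closed convex hull. The
    Donsker-Varadhan bound then puts this infimum below H(nu | mu) + e
    ([weak_duality]).

    For the inequality >=, let v be a real number strictly below H on the
    product K of the two hulls. Every point of K has an f at which
    nu(f) - mu(e^f) + 1 exceeds v, and by compactness finitely many f suffice.
    Concavity in f and convexity in (nu, mu) merge these finitely many f into a
    single one, at any level w < v, on the product of the convex hulls
    ([finite_minimax]). With c = sup_P E_P[e^f], the random variable
    X = e^(f + 1 - c) is an e-variable, since c e^(1 - c) <= 1, and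
    E_Q[log X] = E_Q[f] + 1 - c >= w for every Q ([strong_duality]).

    Only step functions a o p occur in this argument, where I is a finite type,
    p : T -> I has measurable fibers and a : I -> R. General bounded
    measurable functions enter only through the definition of the weak-*
    topology; they are controlled by uniform approximation ([ba_int_approx]). *)

Set Implicit Arguments.
Unset Strict Implicit.
Unset Printing Implicit Defensive.

Import Order.TTheory GRing.Theory Num.Theory.
Import numFieldNormedType.Exports.
Import HBSimple.

Local Open Scope classical_set_scope.

(** * Minimax for convex-like families *)

Section Minimax.
Local Open Scope ring_scope.
Context {R : realType} {X : Type}.
Implicit Types (K : set X) (F : set (X -> R)) (f g : X -> R).

(** Ky Fan's substitute for a convex set K on which every f in F is affine. It
    refers to the values of the functions only, hence to no linear structure on
    X. *)
Definition convexlike F K := forall x y t, K x -> K y -> 0 <= t <= 1 ->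
  exists2 z, K z & forall f, F f -> f z = t * f x + (1 - t) * f y.

(** Ky Fan's substitute for a set of functions f that depend concavely on a
    parameter: a convex combination of two members lies below a third one. *)
Definition concavelike F K := forall f g t, F f -> F g -> 0 <= t <= 1 ->
  exists2 h, F h & forall x, K x -> t * f x + (1 - t) * g x <= h x.

Lemma convexlike_sublevel F K f v : F f -> convexlike F K ->
  convexlike F (K `&` [set x | f x <= v]).
Proof.
move=> Ff cK x y t [Kx fx] [Ky fy] t01.
have [z Kz zE] := cK x y t Kx Ky t01; exists z => //.
split=> //=; rewrite zE//; move: t01 fx fy => /= /andP[t0 t1] fx fy.
by nra.
Qed.

(** A weight t works at x exactly when t >= (w - g x) / (f x - g x) if
    g x < w, and when t <= (g x - w) / (g x - f x) if f x < w. All the lower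
    bounds lie below all the upper bounds: otherwise some point of a segment
    would have f = w and g < w, whereas f or g is at least v everywhere. So the
    supremum of the lower bounds is an admissible weight. *)
Lemma two_function_minimax F K f g v w : F f -> F g -> convexlike F K ->
  (forall x, K x -> v <= f x \/ v <= g x) -> w < v ->
  exists2 t, 0 <= t <= 1 & forall x, K x -> w <= t * f x + (1 - t) * g x.
Proof.
move=> Ff Fg cK fgv wv.
(* Evaluating at the point z of the segment from x to y where f z = w. *)
have key x y : K x -> K y -> f x < w -> g y < w ->
    (w - g y) * (w - f x) <= (g x - w) * (f y - w).
  move=> Kx Ky fx gy.
  have fy : v <= f y by case: (fgv _ Ky) => //; lra.
  have d0 : 0 < f y - f x by lra.
  have [|z Kz zE] := cK x y ((f y - w) / (f y - f x)) Kx Ky.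
    rewrite divr_ge0/= ?ler_pdivrMr; lra.
  have fz : f z = w by rewrite zE//; field; rewrite gt_eqF.
  have gz : v <= g z by case: (fgv _ Kz) => //; lra.
  have : (f y - w) * (g x - w) - (w - f x) * (w - g y) = (f y - f x) * (g z -
    w).
    by rewrite (zE g)//; field; rewrite gt_eqF.
  have : 0 <= (f y - f x) * (g z - w) by apply: mulr_ge0; lra.
  by lra.
(* The lower bounds on the weight; 0 makes the set nonempty. *)
pose S := [set 0 : R] `|` [set (w - g y) / (f y - g y) | y in K `&` [set y | g
  y < w]].
have S1 s : S s -> s <= 1.
  case=> [->//|[y [Ky /= gy] <-]].
  have fy : v <= f y by case: (fgv _ Ky) => //; lra.
  by rewrite ler_pdivrMr; lra.
have S0 : S 0 by left.
have supS : has_sup S by split; [exists 0|exists 1].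
have t0 : 0 <= sup S by apply: ub_le_sup => //; exists 1.
exists (sup S); first by rewrite t0/= ge_sup//; exists 0.
move=> x Kx; have [gx|gx] := ltP (g x) w.
  have fx : v <= f x by case: (fgv _ Kx) => //; lra.
  have : (w - g x) / (f x - g x) <= sup S.
    by apply: ub_le_sup; [exists 1|right; exists x].
  rewrite ler_pdivrMr; last lra.
  by lra.
have [fx|fx] := ltP (f x) w; last first.
  have : sup S <= 1 by apply: ge_sup => //; exists 0.
  by nra.
have gvx : v <= g x by case: (fgv _ Kx) => //; lra.
have : sup S <= (g x - w) / (g x - f x).
  apply: ge_sup; first by exists 0.
  move=> s [->|[y [Ky /= gy] <-]]; first by rewrite divr_ge0//; lra.
  have fy : v <= f y by case: (fgv _ Ky) => //; lra.
  have := key x y Kx Ky fx gy.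
  rewrite ler_pdivrMr; last lra.
  rewrite mulrAC ler_pdivlMr; last lra.
  by lra.
by rewrite ler_pdivlMr; lra.
Qed.

(** Induction on the number of functions, which needs no topology: on the
    sublevel set where g <= w' the remaining functions suffice, so that one
    function f replaces them there; then f and g are merged by
    [two_function_minimax]. Each merging costs a little, whence w < v. *)
Lemma finite_minimax F K (s : seq (X -> R)) v w :
  F !=set0 -> convexlike F K -> concavelike F K ->
  (forall f, f \in s -> F f) ->
  (forall x, K x -> exists2 f, f \in s & v <= f x) -> w < v ->
  exists2 f, F f & forall x, K x -> w <= f x.
Proof.
move=> [f0 Ff0]; elim: s K w => [|g s IHs] K w cK cF sF sv wv.
  by exists f0 => // x /sv[].
pose w' := (w + v) / 2.
have wlt : w < w' by rewrite /w'; lra.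
have ltv : w' < v by rewrite /w'; lra.
have Fg : F g by apply: sF; rewrite mem_head.
pose K' := K `&` [set x | g x <= w'].
have cK' : convexlike F K' by exact: convexlike_sublevel.
have cF' : concavelike F K'.
  move=> h h' t Fh Fh' t01; have [k Fk kK] := cF h h' t Fh Fh' t01.
  by exists k => // x [/kK].
have [||f Ff fK] := IHs K' w' cK' cF' _ _ ltv.
- by move=> h hs; apply: sF; rewrite in_cons hs orbT.
- move=> x [Kx /= gx]; have [h + hx] := sv x Kx.
  rewrite in_cons => /predU1P[hg|hs]; last by exists h.
  by move: hx; rewrite hg; lra.
have fg x : K x -> w' <= f x \/ w' <= g x.
  move=> Kx; have [|gx] := leP w' (g x); first by right.
  by left; apply: fK; split=> //=; exact: ltW.
have [t t01 tK] := two_function_minimax Ff Fg cK fg wlt.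
have [h Fh hK] := cF f g t Ff Fg t01.
by exists h => // x Kx; rewrite (le_trans (tK x Kx))// hK.
Qed.

End Minimax.

(** * Finitely additive integration of step functions *)

Section StepSums.
Local Open Scope ring_scope.
Context {d : measure_display} {T : measurableType d} {R : realType}.
Implicit Types (m : ba T R).

(** Finite measurable partitions are encoded by maps to a finite type. Empty
    cells are harmless and the common refinement of p and q is simply
    x |-> (p x, q x). *)
Definition fiber_measurable (I : finType) (p : T -> I) :=
  forall i, measurable (p @^-1` [set i]).

(** The integral of a o p against the finitely additive measure m. *)
Definition step_sum m (I : finType) (p : T -> I) (a : I -> R) : R :=
  \sum_i a i * m (p @^-1` [set i]).

Lemma ba_nonmeasurable m A : ~ measurable A -> m A = 0.
Proof. by have /set_mem[+ _ _] := ba_valP m; exact. Qed.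

Lemma ba_setU m A B : measurable A -> measurable B -> A `&` B = set0 ->
  m (A `|` B) = m A + m B.
Proof. by have /set_mem[_ + _] := ba_valP m; exact. Qed.

Lemma ba_set0 m : m set0 = 0.
Proof.
have := @ba_setU m set0 set0 measurable0 measurable0 (setI0 _).
by rewrite setU0 => /eqP; rewrite -subr_eq subrr => /eqP.
Qed.

Lemma ba_bounded m : exists2 M : R, 0 <= M & forall A, `|m A| <= M.
Proof.
have /set_mem[_ _ [M mM]] := ba_valP m.
have M0 : 0 <= M by apply: le_trans (mM set0 measurable0).
exists M => // A; have [/mM//|nA] := pselect (measurable A).
by rewrite ba_nonmeasurable// normr0.
Qed.

Lemma fiber_measurable_pred (I : finType) (p : T -> I) (P : {pred I}) :
  fiber_measurable p -> measurable (p @^-1` [set i | i \in P]).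
Proof.
move=> mp; rewrite [X in measurable X](_ : _ =
    \bigcup_(i in [set i | i \in P]) p @^-1` [set i]).
  by apply: fin_bigcup_measurable => //; exact: finite_finset.
by apply/seteqP; split => [x /= xP|x [i /= iP] ->//]; exists (p x).
Qed.

Lemma fiber_measurable_pair (I J : finType) (p : T -> I) (q : T -> J) :
  fiber_measurable p -> fiber_measurable q ->
  fiber_measurable (fun x => (p x, q x)).
Proof.
move=> mp mq [i j].
rewrite [X in measurable X](_ : _ = p @^-1` [set i] `&` q @^-1` [set j]).
  exact: measurableI.
by apply/seteqP; split => [x [<- <-]//|x [/= -> ->]].
Qed.

Lemma ba_preimage_pred m (I : finType) (p : T -> I) (P : {pred I}) :
  fiber_measurable p ->
  m (p @^-1` [set i | i \in P]) = \sum_(i in P) m (p @^-1` [set i]).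
Proof.
move=> mp; suff key s : uniq s ->
    m (p @^-1` [set i | i \in s]) = \sum_(i <- s) m (p @^-1` [set i]).
  rewrite -big_enum/= -key ?enum_uniq//; congr (m _).
  by apply/seteqP; split => x /=; rewrite mem_enum.
elim: s => [_|i s IHs /= /andP[iNs us]].
  by rewrite big_nil -[RHS](ba_set0 m); congr (m _); apply/seteqP; split.
rewrite big_cons -IHs// -ba_setU//.
- congr (m _); apply/seteqP; split => x /=; rewrite in_cons.
    by case/orP => [/eqP|]; [left|right].
  by move=> [/= ->|/= ->]; rewrite ?eqxx ?orbT.
- exact: fiber_measurable_pred.
- by apply/seteqP; split => // x [/= ->]; rewrite (negbTE iNs).
Qed.

(** Merging cells by h does not change the integral. Since both p and q
    factor through (p, q), this allows to compare integrals over different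
    partitions. *)
Lemma step_sum_comp m (I J : finType) (p : T -> I) (h : I -> J) (b : J -> R) :
  fiber_measurable p -> step_sum m (h \o p) b = step_sum m p (b \o h).
Proof.
move=> mp; rewrite /step_sum [RHS](partition_big h xpredT)//=.
apply: eq_bigr => j _.
rewrite (_ : _ @^-1` _ = p @^-1` [set i | i \in [pred i | h i == j]]);
  last first.
  by apply/seteqP; split => x /=; rewrite inE => /eqP.
rewrite ba_preimage_pred// mulr_sumr; apply: eq_big => // i.
by rewrite inE => /eqP ->.
Qed.

Lemma step_sumD m (I : finType) (p : T -> I) (a b : I -> R) :
  step_sum m p (fun i => a i + b i) = step_sum m p a + step_sum m p b.
Proof. by rewrite /step_sum -big_split/=; apply: eq_bigr => i _;
  rewrite mulrDl. Qed.

Lemma step_sumZ m (I : finType) (p : T -> I) (c : R) (a : I -> R) :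
  step_sum m p (fun i => c * a i) = c * step_sum m p a.
Proof. by rewrite /step_sum mulr_sumr; apply: eq_bigr => i _;
  rewrite mulrA. Qed.

Lemma sum_fibers m (I : finType) (p : T -> I) : fiber_measurable p ->
  \sum_i (m : ba T R) (p @^-1` [set i]) = m [set: T].
Proof.
move=> mp; rewrite -(ba_preimage_pred m predT mp); congr (ba_val m _).
by apply/seteqP.
Qed.

Lemma step_sum_cst (m : ba T R) (I : finType) (p : T -> I) (k : R) :
  fiber_measurable p -> step_sum m p (fun=> k) = k * m [set: T].
Proof. by move=> mp; rewrite /step_sum -mulr_sumr sum_fibers. Qed.

Lemma step_sum_comb (c c' : R) m m' (I : finType) (p : T -> I) (a : I -> R) :
  step_sum (c *: m + c' *: m') p a = c * step_sum m p a + c' * step_sum m' p a.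
Proof.
rewrite /step_sum !mulr_sumr -big_split/=; apply: eq_bigr => i _.
by rewrite -[X in a i * X]/(c * m _ + c' * m' _) mulrDr !(mulrCA (a i)).
Qed.

(** The factor 2 M bounds the total variation: the cells of nonnegative mass
    and those of negative mass form two measurable sets, each of mass at most
    M in absolute value. *)
Lemma step_sum_bound (M : R) m (I : finType) (p : T -> I) (a : I -> R) (r : R) :
  fiber_measurable p -> (forall A, `|m A| <= M) ->
  0 <= r -> (forall x, `|a (p x)| <= r) -> `|step_sum m p a| <= r * (2 * M).
Proof.
move=> mp mM r0 ar; apply: le_trans (ler_norm_sum _ _ _) _.
apply: (@le_trans _ _ (r * \sum_i `|m (p @^-1` [set i])|)).
  rewrite mulr_sumr; apply: ler_sum => i _; rewrite normrM.
  have [->|/set0P[x /= px]] := eqVneq (p @^-1` [set i]) set0.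
    by rewrite ba_set0 normr0 !mulr0.
  by apply: ler_wpM2r => //; rewrite -px.
apply: ler_wpM2l => //.
rewrite (bigID (fun i => 0 <= m (p @^-1` [set i])))/=.
rewrite (eq_bigr (fun i => m (p @^-1` [set i]))); last first.
  by move=> i; exact: ger0_norm.
rewrite [X in _ + X](eq_bigr (fun i => - m (p @^-1` [set i]))); last first.
  by move=> i; rewrite -ltNge => /ltr0_norm.
pose P := [pred i | 0 <= m (p @^-1` [set i])].
have Psum := ba_preimage_pred m P mp.
have NPsum := ba_preimage_pred m (predC P) mp.
rewrite sumrN -[X in X - _]Psum -[X in _ - X]NPsum mulr_natl mulr2n lerD//.
  exact: le_trans (ler_norm _) (mM _).
by apply: le_trans (mM (p @^-1` [set i | i \in predC P]));
  rewrite -normrN ler_norm.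
Qed.

(** The bundled simple functions and the functions a o p are the same ones;
    this lemma and the next two pass from one form to the other. *)
Lemma sfun_step (s : {sfun T >-> R}) : exists (I : finType) (p : T -> I) a,
  fiber_measurable p /\ forall x, s x = a (p x).
Proof.
have ps x : s x \in fset_set (range s).
  by rewrite in_fset_set// inE; exists x.
exists (fset_set (range s)), (fun x => [` ps x]%fset), val; split=> // -[y ys].
rewrite [X in measurable X](_ : _ = s @^-1` [set y]).
  exact: measurable_funPTI.
by apply/seteqP; split => x /=; [move=> /(congr1 val)|move=> xy;
  exact: val_inj].
Qed.

Lemma step_sfun (I : finType) (p : T -> I) (a : I -> R) : fiber_measurable p ->
  exists s : {sfun T >-> R}, forall x, s x = a (p x).
Proof.
move=> mp.
have mf : measurable_fun setT (a \o p).
  move=> _ B mB; rewrite setTI comp_preimage.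
  rewrite (_ : a @^-1` B = [set i | i \in [pred i | `[< B (a i) >]]]).
    exact: fiber_measurable_pred.
  by apply/seteqP; split => [i Bi|i /asboolP //]; exact/asboolP.
have ff : finite_set (range (a \o p)).
  apply: (@sub_finite_set _ _ (range a)); first by move=> _ [x _ <-];
    exists (p x).
  by apply: finite_image; exact: finite_finset.
pose m := isMeasurableFun.Build _ _ _ _ (a \o p) mf.
pose f := FiniteImage.Build _ _ (a \o p) ff.
pose s : {sfun T >-> R} := HB.pack_for {sfun T >-> R} (a \o p) m f.
by exists s.
Qed.

Lemma sintegral_step m (I : finType) (p : T -> I) (a : I -> R) (s : T -> R) :
  fiber_measurable p -> (forall x, s x = a (p x)) ->
  sintegral (fun A => (m A)%:E) s = (step_sum m p a)%:E.
Proof.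
(* Distinct cells may carry the same value; r lists each value once. *)
move=> mp sE; pose r := undup [seq a i | i <- enum I].
have ar i : a i \in r by rewrite mem_undup map_f// mem_enum.
rewrite /sintegral (fsbigE r)//=; first last.
- move=> x _ xr; rewrite (_ : _ @^-1` _ = set0) ?ba_set0 ?mule0//.
  by apply/seteqP; split => // y /= yx; move: xr; rewrite -yx sE ar.
- exact: undup_uniq.
rewrite (eq_bigl xpredT); last by move=> x; rewrite in_setT.
rewrite (eq_bigr (fun x => (\sum_(i | a i == x) a i * m (p @^-1` [set i]))%:E)).
  rewrite sumEFin; congr (_%:E); rewrite (exchange_big_dep xpredT)//=.
  apply: eq_bigr => i _.
  rewrite big_mkcond (bigD1_seq (a i)) ?undup_uniq//= eqxx big1 ?addr0//.
  by move=> x; rewrite eq_sym => /negbTE ->.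
move=> x _; rewrite -EFinM; congr (_%:E).
rewrite (_ : _ @^-1` _ = p @^-1` [set i | i \in [pred i | a i == x]]);
  last first.
  by apply/seteqP; split => y /=; rewrite inE sE => /eqP.
by rewrite ba_preimage_pred// mulr_sumr; apply: eq_bigr => i /eqP ->.
Qed.

End StepSums.

(** * The integral of bounded measurable functions *)

Section Integral.
Local Open Scope ring_scope.
Context {d : measure_display} {T : measurableType d} {R : realType}.
Implicit Types (m : ba T R).

(** Rounding f up to a multiple of r, after a shift by B that makes f
    nonnegative. *)
Lemma step_approximation (f : T -> R) (B r : R) :
  measurable_fun [set: T] f -> (forall x, `|f x| <= B) -> 0 < r ->
  exists (I : finType) (p : T -> I) (a : I -> R),
    fiber_measurable p /\ forall x, f x <= a (p x) <= f x + r.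
Proof.
(* The index of the level of f, counted from - B in steps of r. *)
move=> mf fB r0; pose k x := Num.truncn ((f x + B) / r).
have f0 x : 0 <= (f x + B) / r.
  by rewrite divr_ge0 ?(ltW r0)//; have := fB x; rewrite ler_norml; lra.
have kN x : (k x < (Num.truncn (2 * B / r)).+1)%N.
  rewrite ltnS; apply: le_truncn; rewrite ler_pM2r ?invr_gt0//.
  by have := fB x; rewrite ler_norml; lra.
have kP x : (k x)%:R * r <= f x + B < (k x).+1%:R * r.
  by have := truncn_itv (f0 x); rewrite ler_pdivlMr// ltr_pdivrMr.
exists 'I_(Num.truncn (2 * B / r)).+1, (fun x => Ordinal (kN x)),
  (fun i : 'I_(_) => (val i).+1%:R * r - B); split=> [i|x]; last first.
  by have /andP[] := kP x; rewrite /= -[in _.+1%:R]addn1 natrD; lra.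
rewrite [X in measurable X](_ : _ =
    [set: T] `&` f @^-1` `[i%:R * r - B, i.+1%:R * r - B[%classic).
  by apply: mf.
apply/seteqP; split => x /=; rewrite in_itv/=.
  by move=> <- /=; split=> //; have := kP x; lra.
move=> [_ xi]; apply/val_inj => /=.
apply: truncn_def.
by rewrite ler_pdivlMr// ltr_pdivrMr//; lra.
Qed.

Lemma Bb_bounded (f : @Bb d T R) : exists B, forall x, `|sval f x| <= B.
Proof.
have [M [_ MP]] := svalP f; exists (M + 1) => x.
by apply: MP => //; rewrite ltrDl.
Qed.

Lemma step_sum_close (M : R) m (f : T -> R) (I J : finType) (p : T -> I)
    (q : T -> J) (a : I -> R) (b : J -> R) (r s : R) :
  fiber_measurable p -> fiber_measurable q -> (forall A, `|m A| <= M) ->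
  0 <= r -> 0 <= s -> (forall x, `|f x - a (p x)| <= r) ->
  (forall x, `|f x - b (q x)| <= s) ->
  `|step_sum m p a - step_sum m q b| <= (r + s) * (2 * M).
Proof.
move=> mp mq mM r0 s0 far fbs; have mpq := fiber_measurable_pair mp mq.
have -> : step_sum m p a = step_sum m (fun x => (p x, q x)) (a \o fst).
  by rewrite -(step_sum_comp m fst a mpq).
have -> : step_sum m q b = step_sum m (fun x => (p x, q x)) (b \o snd).
  by rewrite -(step_sum_comp m snd b mpq).
rewrite -[X in _ - X]mul1r -mulNr -step_sumZ -step_sumD.
apply: step_sum_bound => //=; first exact: addr_ge0.
move=> x; have := far x; have := fbs x; rewrite !ler_norml; lra.
Qed.

(** The integral in the definition of the weak-* topology is selected by a
    choice operator; this estimate is the property that makes it usable.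
    Existence: the numbers step_sum m p a - r * (2 * M), for all step functions
    a o p at distance at most r from f, lie below all the numbers
    step_sum m q b + s * (2 * M) of the same kind, so that the supremum of the
    former is within r * (2 * M) of each integral. Uniqueness: any two
    candidates are close to the integral of one and the same fine step
    function. *)
Lemma ba_int_approx (M : R) m (f : Bb) (I : finType) (p : T -> I) (a : I -> R)
    (r : R) : fiber_measurable p -> (forall A, `|m A| <= M) ->
  0 <= r -> (forall x, `|sval f x - a (p x)| <= r) ->
  `|ba_int m f - step_sum m p a| <= r * (2 * M).
Proof.
move=> mp mM r0 far.
have M0 : 0 <= M by apply: le_trans (mM set0).
have [B fB] := Bb_bounded f.
have mf : measurable_fun [set: T] (sval f) by [].
have approx e : 0 < e -> exists (I : finType) (p : T -> I) (a : I -> R),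
    fiber_measurable p /\ forall x, `|sval f x - a (p x)| <= e.
  move=> e0; have [J [q [b [mq qb]]]] := step_approximation mf fB e0.
  exists J, q, b; split=> // x; have := qb x; rewrite ler_norml; lra.
pose L := [set l | exists (I : finType) (p : T -> I) (a : I -> R) s,
  [/\ fiber_measurable p, 0 <= s, forall x, `|sval f x - a (p x)| <= s
    & l = step_sum m p a - s * (2 * M)]].
have Lub (J : finType) (q : T -> J) (b : J -> R) s :
    fiber_measurable q -> 0 <= s -> (forall x, `|sval f x - b (q x)| <= s) ->
    ubound L (step_sum m q b + s * (2 * M)).
  move=> mq s0 fbs _ [K [q' [b' [s' [mq' s'0 fbs' ->]]]]].
  have := step_sum_close mq mq' mM s0 s'0 fbs fbs'.
  by rewrite ler_norml; lra.
have L0 : L !=set0.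
  by exists (step_sum m p a - r * (2 * M)), I, p, a, r.
have supL : has_sup L.
  by split=> //; exists (step_sum m p a + r * (2 * M)); exact: Lub.
have LP (J : finType) (q : T -> J) (b : J -> R) s :
    fiber_measurable q -> 0 <= s -> (forall x, `|sval f x - b (q x)| <= s) ->
    `|sup L - step_sum m q b| <= s * (2 * M).
  move=> mq s0 fbs; rewrite ler_distl; apply/andP; split.
    by apply: ub_le_sup; [case: supL|exists J, q, b, s].
  by apply: ge_sup => //; exact: Lub.
suff -> : ba_int m f = sup L by exact: LP.
have eC e : 0 < e -> 0 < e / (2 * M + 1) /\ e / (2 * M + 1) * (2 * M) <= e.
  move=> e0; have C0 : 0 < 2 * M + 1 by lra.
  split; first exact: divr_gt0.
  by rewrite -mulrA ler_piMr ?(ltW e0)// mulrC ler_pdivrMr//; lra.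
have : [set l : R | forall e : R, 0 < e -> exists2 r : R, 0 < r &
    forall s : {sfun T >-> R}, (forall x, `|sval f x - s x| <= r) ->
      `|l - fine (sintegral (fun A => (m A)%:E) s)| <= e] (ba_int m f).
  rewrite /ba_int; apply: getPex; exists (sup L) => e e0.
  have [s0 se] := eC _ e0; exists (e / (2 * M + 1)) => // s fs.
  have [J [q [b [mq sE]]]] := sfun_step s.
  rewrite (sintegral_step _ mq sE)/= (le_trans _ se)//.
  by apply: LP => //; [exact: ltW|move=> x; rewrite -sE].
move: (ba_int m f) => l lP; apply/eqP; rewrite -subr_eq0 -normr_le0.
apply/ler_addgt0Pr => e e0; rewrite add0r;
  have e20 : 0 < e / 2 by rewrite divr_gt0.
have [s0 s0P ls] := lP _ e20.
have [t0 te] := eC _ e20.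
have [|J [q [b [mq qb]]]] := approx (Num.min s0 (e / 2 / (2 * M + 1))).
  by rewrite lt_min s0P.
have [s sE] := step_sfun b mq.
have : `|l - step_sum m q b| <= e / 2.
  have := ls s; rewrite (sintegral_step _ mq sE)/=; apply => x.
  by rewrite sE (le_trans (qb x))// ge_min lexx.
have : `|sup L - step_sum m q b| <= e / 2.
  rewrite (le_trans _ te)//; apply: LP => //; first exact: ltW.
  by move=> x; rewrite (le_trans (qb x))// ge_min lexx orbT.
by rewrite !ler_norml; lra.
Qed.

End Integral.

(** * Weak-* topology: half-spaces and compactness *)

Section Filters.

(** Meant for integration against the functions in B_b, which is far from being
    onto the space of all functions on B_b. *)
Lemma cvg_initial {S : choiceType} {V : topologicalType} (f : S -> V)
    (F : set_system S) (s : S) : Filter F ->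
  f @ F --> f s -> F --> (s : initial_topology f).
Proof.
move=> FF fF A [_ [[B Bop <-] Bs BA]].
have : nbhs (f s) B by exact: open_nbhs_nbhs.
by move=> /fF FB; apply: (filterS BA); exact: FB.
Qed.

Lemma fmap_ultra {S V : Type} (f : S -> V) (F : set_system S) :
  UltraFilter F -> UltraFilter (f @ F).
Proof.
move=> FU; split; first exact: fmap_proper_filter.
move=> G GP FG; apply/seteqP; split; last exact: FG.
move=> A GA; have [//|FA] := in_ultra_setVsetC (f @^-1` A) FU.
have /(filterI GA) : G (~` A) by exact: FG.
by rewrite setICr => /filter_not_empty.
Qed.

End Filters.

Section WeakStar.
Local Open Scope ring_scope.
Context {d : measure_display} {T : measurableType d} {R : realType}.
Implicit Types (m : ba T R) (QQ : set (probability T R)).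

Notation W := (@wstar_ba d T R).

Lemma step_Bb (I : finType) (p : T -> I) (a : I -> R) : fiber_measurable p ->
  exists f : @Bb d T R, forall x, sval f x = a (p x).
Proof.
move=> mp; have [s sE] := step_sfun a mp.
have bs : [bounded (s : {mfun T >-> R}) x | x in [set: T]].
  exists (\sum_i `|a i|); split; first exact: num_real.
  move=> M aM x _; apply: ltW; apply: le_lt_trans aM.
  rewrite /= sE (bigD1 (p x))//= lerDl; exact: sumr_ge0.
by exists (exist _ (s : {mfun T >-> R}) bs).
Qed.

Lemma ba_int_step m (f : Bb) (I : finType) (p : T -> I) (a : I -> R) :
  fiber_measurable p -> (forall x, sval f x = a (p x)) ->
  ba_int m f = step_sum m p a.
Proof.
move=> mp fE; have [M _ mM] := ba_bounded m.
apply/eqP; rewrite -subr_eq0 -normr_le0.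
have := @ba_int_approx _ _ _ M m f _ p a 0 mp mM (lexx _).
by rewrite mul0r; apply => x; rewrite fE subrr normr0.
Qed.

(** A step function is a member of B_b, at which the weak-* topology makes
    integration continuous by definition. *)
Lemma step_sum_continuous (I : finType) (p : T -> I) (a : I -> R) :
  fiber_measurable p -> continuous (fun m : W => step_sum m p a : R).
Proof.
move=> mp; have [f fE] := step_Bb a mp.
rewrite (_ : (fun m : W => _) = (fun g : {ptws @Bb d T R -> R} => g f) \o
    (@ba_int d T R : W -> {ptws @Bb d T R -> R})); last first.
  by apply/funext => m /=; rewrite (ba_int_step m mp fE).
move=> m; apply: continuous_comp; first exact: initial_continuous.
exact: (@proj_continuous _ (fun _ : @Bb d T R => R^o) f).
Qed.

Lemma wstar_cvg (F : set_system W) (m : W) : Filter F ->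
  (forall f, (fun m' : W => ba_int m' f) @ F --> ba_int m f) -> F --> m.
Proof.
move=> FF Fm; apply: cvg_initial; apply/cvg_sup => f.
by apply: cvg_initial; exact: Fm.
Qed.

Lemma co_convex (S : set (ba T R)) (t : R) m m' : 0 <= t <= 1 ->
  co S m -> co S m' -> co S (t *: m + (1 - t) *: m').
Proof.
move=> /andP[t0 t1] Sm Sm' A [cA SA].
have := cA m m' (Itv01 t0 t1); rewrite !inE; apply.
  by apply: Sm.
by apply: Sm'.
Qed.

Lemma co_sub_wstar_cco (S : set (ba T R)) : co S `<=` wstar_cco S.
Proof. exact: (@subset_closure W). Qed.

Lemma co_halfspace (S : set (ba T R)) (I : finType) (p : T -> I) (a : I -> R)
    (c : R) :
  (forall m, S m -> c <= step_sum m p a) -> forall m, co S m ->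
  c <= step_sum m p a.
Proof.
move=> Sc; apply: smallest_sub => //.
move=> m m' l; rewrite !inE /= => cm cm'.
rewrite [X in step_sum X](_ : _ = l%:num *: m + (1 - l%:num) *: m')//.
rewrite step_sum_comb.
have l0 : 0 <= l%:num by [].
have l1 : l%:num <= 1 by [].
move: cm cm' l0 l1; move: (step_sum m p a) (step_sum m' p a) l%:num => x y t.
by move=> cx cy t0 t1; nra.
Qed.

(** Weak-* closed half-spaces given by step functions pass to the weak-* closed
    convex hull. Every bound on the elements of such a hull comes from
    this lemma. *)
Lemma wstar_cco_halfspace (S : set (ba T R)) (I : finType) (p : T -> I)
    (a : I -> R) (c : R) : fiber_measurable p ->
  (forall m, S m -> c <= step_sum m p a) -> forall m, wstar_cco S m ->
  c <= step_sum m p a.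
Proof.
move=> mp Sc m Sm; rewrite leNgt; apply/negP => mc.
have mn : nbhs (m : W) [set m' | step_sum m' p a < c].
  exact: cvgr_lt (@step_sum_continuous _ p a mp m) _ mc.
have [m' [Sm' /= m'c]] := Sm _ mn.
by have := co_halfspace Sc Sm'; rewrite leNgt m'c.
Qed.

Lemma wstar_cco_halfspace_le (S : set (ba T R)) (I : finType) (p : T -> I)
    (a : I -> R) (c : R) : fiber_measurable p ->
  (forall m, S m -> step_sum m p a <= c) -> forall m, wstar_cco S m ->
  step_sum m p a <= c.
Proof.
move=> mp Sc m Sm; rewrite -lerN2 -[leRHS]mulN1r -step_sumZ.
apply: wstar_cco_halfspace Sm => // m' Sm'.
by rewrite step_sumZ mulN1r lerN2 Sc.
Qed.

Lemma set_fiber_measurable (A : set T) : measurable A ->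
  fiber_measurable (fun x => `[< A x >]).
Proof.
move=> mA [].
  rewrite (_ : _ @^-1` _ = A)//.
  by apply/seteqP; split => x /=; case: asboolP.
rewrite (_ : _ @^-1` _ = ~` A); first exact: measurableC.
by apply/seteqP; split => x /=; case: asboolP.
Qed.

Lemma step_sum_set m (A : set T) : measurable A ->
  step_sum m (fun x => `[< A x >]) (fun b => b%:R) = m A.
Proof.
move=> mA; rewrite /step_sum big_bool/= mul0r addr0 mul1r; congr (m _).
by apply/seteqP; split => x /=; case: asboolP.
Qed.

Lemma prob_ba_ge0 (Q : probability T R) A : 0 <= prob_ba Q A.
Proof. by rewrite /= /prob_fun; case: asboolP => // mA; exact: fine_ge0. Qed.

Lemma prob_baT (Q : probability T R) : prob_ba Q [set: T] = 1.
Proof. by rewrite /= /prob_fun asboolT// probability_setT. Qed.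

Lemma wstar_cco_nonempty QQ : QQ !=set0 -> wstar_cco (prob_ba @` QQ) !=set0.
Proof.
move=> [Q QQQ]; exists (prob_ba Q); apply: co_sub_wstar_cco.
by apply: sub_gen_smallest; exists Q.
Qed.

(** The set ba_1. Positivity is stated on all subsets, the elements of ba
    being 0 off the sigma-algebra. *)
Definition ba_prob m := (forall A, 0 <= m A) /\ m [set: T] = 1.

Lemma ba_prob_le1 m A : ba_prob m -> m A <= 1.
Proof.
move=> [m0 m1]; have [mA|nA] := pselect (measurable A); last first.
  by rewrite ba_nonmeasurable.
rewrite -m1 -(setUv A) ba_setU ?setICr//; last exact: measurableC.
by rewrite lerDl.
Qed.

Lemma wstar_cco_prob QQ m : wstar_cco (prob_ba @` QQ) m -> ba_prob m.
Proof.
move=> Km; have ge0 A : 0 <= m A.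
  have [mA|nA] := pselect (measurable A); last by rewrite ba_nonmeasurable.
  rewrite -(step_sum_set _ mA); apply: wstar_cco_halfspace Km.
    exact: set_fiber_measurable.
  by move=> _ [Q _ <-]; rewrite step_sum_set//; exact: prob_ba_ge0.
split => //; have mp := set_fiber_measurable (@measurableT _ T).
apply: le_anti; rewrite -(step_sum_set _ measurableT); apply/andP; split.
  apply: wstar_cco_halfspace_le Km => //.
  by move=> _ [Q _ <-]; rewrite step_sum_set// prob_baT.
apply: wstar_cco_halfspace Km => //.
by move=> _ [Q _ <-]; rewrite step_sum_set// prob_baT.
Qed.

(** Banach-Alaoglu for this set. Along an ultrafilter the values m A, which
    lie in [0, 1], converge for every A, and the limits form a finitely
    additive probability m0. Step functions are integrated by finite sums, so
    that their integrals converge as well; a general f in B_b is uniformly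
    close to one of them, with the same error for all m, whence convergence to
    m0 in the weak-* topology. *)
Lemma wstar_cco_compact QQ : compact (wstar_cco (prob_ba @` QQ) : set W).
Proof.
rewrite compact_ultra => F FU FK.
have FP : \forall m \near F, ba_prob (m : ba T R).
  by apply: filterS FK => m; exact: wstar_cco_prob.
have lim A : exists l : R, (fun m : W => m A : R) @ F --> l.
  have K01 := @segment_compact R 0 1; rewrite compact_ultra in K01.
  have [|l [_ ?]] := K01 _ (fmap_ultra (fun m : W => m A : R) FU);
    last by exists l.
  by apply: filterS FP => m mP; rewrite /= in_itv/= ba_prob_le1//;
    case: mP => ->.
have [l lP] := choice lim.
have lE A x : (fun m : W => m A : R) @ F --> x -> l A = x.
  by move=> mx; apply: cvg_unique (lP A) mx; exact: norm_hausdorff.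
have l01 A : 0 <= l A <= 1.
  suff : `[0, 1]%classic (l A) by rewrite /= in_itv.
  apply: (closed_cvg _ (@interval_closed R _ _ _ _) _ _ (lP A)) => //.
  by apply: filterS FP => m mP; rewrite /= in_itv/= ba_prob_le1//;
    case: mP => ->.
have l_ba : (l : set T -> R^o) \in ba_pred.
  apply/mem_set; split.
  - move=> A nA; apply: lE; rewrite (_ : (fun m : W => _) = cst 0).
      exact: cvg_cst.
    by apply/funext => m; rewrite ba_nonmeasurable.
  - move=> A B mA mB AB; apply: lE.
    rewrite (_ : (fun m : W => _) = (fun m : W => m A : R) \+ (fun m : W =>
      m B : R)).
      by apply: cvgD; exact: lP.
    by apply/funext => m; rewrite ba_setU.
  - by exists 1 => A _; have := l01 A; rewrite ler_norml; lra.
pose m0 : W := BoundedCharge l_ba.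
have Fm0 : F --> m0.
  apply: wstar_cvg => f; apply/cvgrPdist_le => e e0.
  have [B fB] := Bb_bounded f.
  have e6 : 0 < e / 6 by rewrite divr_gt0.
  have mf : measurable_fun [set: T] (sval f) by [].
  have [I [p [a [mp pa]]]] := step_approximation mf fB e6.
  have fa x : `|sval f x - a (p x)| <= e / 6.
    by have := pa x; rewrite ler_norml; lra.
  have le1 (m : W) : ba_prob (m : ba T R) -> forall A, `|m A| <= 1.
    by move=> mP A; rewrite ger0_norm ?ba_prob_le1//; case: mP.
  have Fs : (fun m : W => step_sum m p a) @ F --> step_sum m0 p a.
    apply: cvg_big => [|i _]; first exact: add_continuous.
    by apply: cvgMl_tmp; exact: lP.
  have m0le A : `|m0 A| <= 1 by have := l01 A; rewrite ler_norml /=; lra.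
  move/cvgrPdist_le : Fs => /(_ _ e6) Fs.
  near=> m.
  have mP : ba_prob (m : ba T R) by near: m.
  have := ba_int_approx mp m0le (ltW e6) fa.
  have := ba_int_approx mp (le1 _ mP) (ltW e6) fa.
  have : `|step_sum m0 p a - step_sum m p a| <= e / 6 by near: m.
  by rewrite !ler_norml; lra.
exists m0; split => //.
apply: (closed_cvg (u_ := id) _ (@closed_closure W _) FK _ Fm0).
Unshelve. all: by end_near.
Qed.

End WeakStar.

(** * Minimisation over a compact set *)

Section CompactMinimum.
Local Open Scope ring_scope.
Context {R : realType} {Z : topologicalType}.
Implicit Types (K : set Z) (F : set (Z -> R)).

Lemma ereal_between (x y : \bar R) : (x < y)%E ->
  exists c : R, (x < c%:E)%E /\ (c%:E < y)%E.
Proof.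
move: x y => [x| |] [y| |] //=; rewrite ?lte_fin.
- by move=> xy; exists ((x + y) / 2); rewrite !lte_fin; split; lra.
- by move=> _; exists (x + 1); rewrite lte_fin ltrDl ltr01 ltry.
- by move=> _; exists (y - 1); rewrite lte_fin ltrBlDr ltrDl ltr01 ltNyr.
- by move=> _; exists 0; rewrite ltNyr ltry.
Qed.

(** Compactness in its near-covering form, applied to the filter of the
    finite families that contain a given finite subfamily of F. *)
Lemma compact_finite_family K F (v : R) : compact K ->
  (forall f, F f -> continuous f) ->
  (forall x, K x -> exists2 f, F f & v < f x) ->
  exists2 s : seq (Z -> R), (forall f, f \in s -> F f) &
    forall x, K x -> exists2 f, f \in s & v < f x.
Proof.
rewrite compact_near_coveringP => cK cF FK.
pose G := [set P : set (seq (Z -> R)) | exists2 s0 : seq (Z -> R),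
  (forall f, f \in s0 -> F f) & forall s : seq (Z -> R),
    {subset s0 <= s} -> P s].
have GF : Filter G.
  split=> [|P Q [s Fs sP] [t Ft tQ]|P Q PQ [s Fs sP]].
  - by exists [::].
  - exists (s ++ t) => [f|u stu]; first by rewrite mem_cat => /orP[/Fs|/Ft].
    by split; [apply: sP|apply: tQ] => f fs; apply: stu;
      rewrite mem_cat fs ?orbT.
  - by exists s => // t /sP; exact: PQ.
have [|s Fs sK] := cK _ G (fun s x => exists2 f, f \in s & v < f x) GF;
  last first.
  by exists s => // x; exact: sK.
move=> x Kx; have [f Ff vf] := FK x Kx.
exists ([set y | v < f y], [set s : seq (Z -> R) | f \in s]) => /=; last first.
  by move=> [y s] [/= vy fs]; exists f.
split; last by exists [:: f] => [g|s]; [rewrite inE => /eqP ->|apply;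
  rewrite inE].
exact: cvgr_gt (cF f Ff x) _ vf.
Qed.

(** If the infimum m was not attained, every point x of K would have a real
    c and an f in F with m < c < f x. By compactness finitely many pairs
    (f, c) would do for all of K, and the smallest of their levels c would be a
    lower bound of H above m. *)
Lemma compact_attains_inf K F (H : Z -> \bar R) : compact K -> K !=set0 ->
  (forall f, F f -> continuous f) ->
  (forall f x, F f -> K x -> ((f x)%:E <= H x)%E) ->
  (forall x c, K x -> (c%:E < H x)%E -> exists2 f, F f & c < f x) ->
  exists2 x, K x & H x = ereal_inf (H @` K).
Proof.
move=> cK [x0 Kx0] cF FH HF; apply: contrapT => nK.
set m := ereal_inf (H @` K) in nK.
have mH x : K x -> (m < H x)%E.
  move=> Kx; rewrite lt_neqAle; apply/andP; split.
    by apply/eqP => mx; apply: nK; exists x.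
  by apply: ereal_inf_lbound; exists x.
pose G := [set g | exists f c, [/\ F f, (m < c%:E)%E & g = (fun x => f x - c)]].
have [||s sG sK] := @compact_finite_family K G 0 cK.
- move=> _ [f [c [Ff _ ->]]] x.
  by apply: cvgB; [exact: cF|exact: cvg_cst].
- move=> x Kx; have [c [mc cH]] := ereal_between (mH x Kx).
  have [f Ff cf] := HF x c Kx cH.
  by exists (fun x => f x - c); [exists f, c|rewrite subr_gt0].
(* The minimum over s of the levels c attached to its members. *)
have [c mc cs] : exists2 c : R, (m < c%:E)%E &
    forall x g, K x -> g \in s -> 0 < g x -> (c%:E <= H x)%E.
  elim: {sK} s sG => [_|g s IHs sG].
    by have [c [mc _]] := ereal_between (mH x0 Kx0); exists c.
  have [|c mc cs] := IHs; first by move=> h hs; apply: sG;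
    rewrite in_cons hs orbT.
  have [f [c' [Ff mc' gE]]] := sG g (mem_head _ _).
  exists (Num.min c c'); first by rewrite EFin_min lt_min mc.
  move=> x h Kx; rewrite in_cons EFin_min ge_min => /predU1P[->|hs].
    rewrite gE subr_gt0 => cf; apply/orP; right.
    by rewrite (le_trans _ (FH f x Ff Kx))// lee_fin ltW.
  by move=> hx; rewrite (cs x h).
have : (c%:E <= m)%E.
  apply: le_ereal_inf_tmp => _ [x Kx <-].
  by have [g gs gx] := sK x Kx; exact: cs gx.
by rewrite leNgt mc.
Qed.

End CompactMinimum.

(** * Variational formula for the relative entropy *)

Section Entropy.
Local Open Scope ring_scope.
Context {d : measure_display} {T : measurableType d} {R : realType}.
Implicit Types (mu nu : ba T R).

(** Young's inequality. For p, q > 0 it is 1 + u <= e^u at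
    u = a - ln (q / p). *)
Lemma entropy_term_ge (a q p : R) : 0 <= q -> 0 <= p ->
  ((a * q - expR a * p + q)%:E <= entropy_term q p)%E.
Proof.
move=> q0 p0; rewrite /entropy_term; case: eqVneq => [->|qn0].
  by rewrite lee_fin mulr0 addr0 add0r oppr_le0 mulr_ge0// expR_ge0.
case: eqVneq => [_|pn0]; first exact: leey.
have {}q0 : 0 < q by rewrite lt_def qn0.
have {}p0 : 0 < p by rewrite lt_def pn0.
have := expR_ge1Dx (a - ln (q / p)).
rewrite lee_fin expRD expRN lnK ?posrE ?divr_gt0// invf_div mulrA ler_pdivlMr//.
by lra.
Qed.

(** The optimal a is ln (q / p). It does not exist when q = 0 < p, where a
    tends to -oo, nor when p = 0 < q, where it tends to +oo. *)
Lemma entropy_term_approx (q p c : R) : 0 <= q -> 0 <= p ->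
  (c%:E < entropy_term q p)%E -> exists a, c < a * q - expR a * p + q.
Proof.
move=> q0 p0; rewrite /entropy_term; case: eqVneq => [->|qn0].
  rewrite lte_fin => c0; have [->|pn0] := eqVneq p 0.
    by exists 0; rewrite !mulr0 subr0 addr0.
  have {}p0 : 0 < p by rewrite lt_def pn0.
  have c2 : 0 < - c / 2 / p by rewrite !divr_gt0//; lra.
  exists (ln (- c / 2 / p)).
  by rewrite lnK ?posrE// divfK//; lra.
have {}q0 : 0 < q by rewrite lt_def qn0.
case: eqVneq => [-> _|pn0].
  by exists ((c + 1 - q) / q); rewrite divfK//; lra.
have {}p0 : 0 < p by rewrite lt_def pn0.
rewrite lte_fin => cq; exists (ln (q / p)).
by rewrite lnK ?posrE ?divr_gt0// divfK//; lra.
Qed.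

Lemma lte_split (x y : \bar R) (c : R) : x != -oo%E -> y != -oo%E ->
  (c%:E < x + y)%E ->
  exists c1 c2, [/\ c = c1 + c2, (c1%:E < x)%E & (c2%:E < y)%E].
Proof.
move: x y => [x| |] [y| |] //= _ _; rewrite -?EFinD ?lte_fin => cxy.
- by exists (x - (x + y - c) / 2), (y - (x + y - c) / 2); rewrite !lte_fin;
    split; lra.
- by exists (x - 1), (c - (x - 1)); rewrite lte_fin ltry; split => //; lra.
- by exists (c - (y - 1)), (y - 1); rewrite lte_fin ltry; split => //; lra.
- by exists c, 0; rewrite addr0 !ltry.
Qed.

(** A sum of suprema taken over independent parameters is the supremum of
    the sum. *)
Lemma lte_sum_split (I : eqType) (t : I -> \bar R) (g : I -> R -> R)
    (s : seq I) (c : R) : uniq s -> (forall i, t i != -oo%E) ->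
  (forall i c, (c%:E < t i)%E -> exists a, c < g i a) ->
  (c%:E < \sum_(i <- s) t i)%E ->
  exists a : I -> R, c < \sum_(i <- s) g i (a i).
Proof.
move=> + tNy tg; elim: s c => [c _|i s IHs c /= /andP[is_ us]].
  by rewrite big_nil lte_fin => c0; exists (fun=> 0); rewrite big_nil.
rewrite big_cons => /lte_split[//| |c1 [c2 [-> c1t c2s]]].
  elim: (s) => [|j r IHr]; first by rewrite big_nil.
  by rewrite big_cons adde_eq_ninfty negb_or tNy.
have [b bP] := tg i c1 c1t; have [a aP] := IHs c2 us c2s.
exists (fun j => if j == i then b else a j).
rewrite big_cons eqxx ltrD// (eq_big_seq (fun j => g j (a j)))//.
by move=> j js; rewrite ifN//; apply: contraNneq is_ => <-.
Qed.

(** nu(f) - mu(e^f) + 1 for f = a o p. In contrast with nu(f) - log mu(e^f)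
    it is affine in mu, and the supremum over f is the same when nu and mu have
    mass 1. *)
Definition donsker_varadhan nu mu (I : finType) (p : T -> I) (a : I -> R) : R :=
  step_sum nu p a - step_sum mu p (expR \o a) + 1.

Lemma donsker_varadhanE nu mu (I : finType) (p : T -> I) (a : I -> R) :
  fiber_measurable p -> nu [set: T] = 1 ->
  donsker_varadhan nu mu p a = \sum_i (a i * nu (p @^-1` [set i]) -
    expR (a i) * mu (p @^-1` [set i]) + nu (p @^-1` [set i])).
Proof.
by move=> mp nu1; rewrite big_split/= sum_fibers// nu1 sumrB.
Qed.

(** The blocks of a partition have to be nonempty, so that the entropy is
    evaluated on the nonempty fibers of p, enumerated by an ordinal; on the
    others both sides vanish. *)
Lemma donsker_varadhan_le nu mu (I : finType) (p : T -> I) (a : I -> R) :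
  fiber_measurable p -> ba_prob nu -> ba_prob mu ->
  ((donsker_varadhan nu mu p a)%:E <= relative_entropy nu mu)%E.
Proof.
move=> mp [nu0 nu1] [mu0 _]; rewrite donsker_varadhanE//.
pose J := [set i | `[< p @^-1` [set i] !=set0 >]]%SET.
have Jp x : p x \in J by rewrite inE; apply/asboolP; exists x.
have NJ i : i \notin J -> p @^-1` [set i] = set0.
  by rewrite inE => /asboolPn /set0P/negP; rewrite negbK => /eqP.
apply: (@le_trans _ _ (partition_entropy nu mu
    (fun k : 'I_#|J| => p @^-1` [set enum_val k]))); last first.
  apply: ereal_sup_ubound; exists #|J|, (fun k => p @^-1` [set enum_val k]).
  split=> //; split.
  - apply/seteqP; split=> // x _; exists (enum_rank_in (Jp x) (p x)) => //=.
    by rewrite enum_rankK_in.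
  - move=> k l _ _ [x [/= pk pl]]; apply: enum_val_inj; congruence.
  - by move=> k _; have := enum_valP k; rewrite inE => /asboolP.
rewrite /partition_entropy.
rewrite -(big_enum_val (fun i => entropy_term (nu (p @^-1` [set i]))
  (mu (p @^-1` [set i]))))/=.
rewrite (bigID (mem J))/= [X in _ + X]big1 ?addr0; last first.
  by move=> i /NJ ->; rewrite !ba_set0 !mulr0 addr0 subr0.
rewrite -sumEFin; apply: lee_sum => i _; exact: entropy_term_ge.
Qed.

Lemma donsker_varadhan_approx nu mu (c : R) : ba_prob nu -> ba_prob mu ->
  (c%:E < relative_entropy nu mu)%E ->
  exists (I : finType) (p : T -> I) (a : I -> R),
    fiber_measurable p /\ c < donsker_varadhan nu mu p a.
Proof.
move=> [nu0 nu1] [mu0 _] /ereal_sup_gt[_ [n [A [mA [AT tA _] ->]]]] cA.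
have /choice[p pA] x : exists i, A i x.
  have : [set: T] x by [].
  by rewrite -AT => -[i _ Ai]; exists i.
have pE i : p @^-1` [set i] = A i.
  apply/seteqP; split=> [x /= <-//|x Ax]; apply: tA => //.
  by exists x; split=> //; exact: pA.
have mp : fiber_measurable p by move=> i; rewrite pE.
rewrite /partition_entropy in cA.
have [||a aP] := @lte_sum_split _ (fun i => entropy_term (nu (A i)) (mu (A i)))
  (fun i a => a * nu (A i) - expR a * mu (A i) + nu (A i)) _ _
  (index_enum_uniq 'I_n) _ _ cA.
- by move=> i; rewrite /entropy_term; case: ifP => // _; case: ifP.
- by move=> i c'; exact: entropy_term_approx.
exists 'I_n, p, a; split => //; rewrite donsker_varadhanE//.
by under eq_bigr do rewrite pE.
Qed.

End Entropy.

(** * Expectations of step functions *)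

Section Expectations.
Local Open Scope ring_scope.
Context {d : measure_display} {T : measurableType d} {R : realType}.
Implicit Types (P Q : probability T R).

Lemma measurable_step (I : finType) (p : T -> I) (a : I -> R) :
  fiber_measurable p -> measurable_fun [set: T] (fun x => (a (p x))%:E).
Proof.
move=> mp; have [s sE] := step_sfun a mp; apply/measurable_EFinP.
by apply: (eq_measurable_fun s) => // x _; rewrite sE.
Qed.

Lemma ge0_integral_step P (I : finType) (p : T -> I) (a : I -> R) :
  fiber_measurable p -> (forall i, 0 <= a i) ->
  (\int[P]_x (a (p x))%:E = (step_sum (prob_ba P) p a)%:E)%E.
Proof.
move=> mp a0.
transitivity (\int[P]_x (\sum_i (a i)%:E * (\1_(p @^-1` [set i]) x)%:E))%E.
  apply: eq_integral => x _; rewrite (bigD1 (p x))//= big1 ?adde0.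
    by rewrite indicE mem_set// mule1.
  by move=> i ipx; rewrite indicE memNset ?mule0// => /= pxi;
    rewrite pxi eqxx in ipx.
have mI i : measurable_fun [set: T] (EFin \o \1_(p @^-1` [set i] : set T) : T
  -> \bar R).
  by apply/measurable_EFinP; exact: measurable_indic.
rewrite ge0_integral_sum//; last 2 first.
- by move=> i; apply: emeasurable_funM => //; exact: mI.
- by move=> i x _; rewrite mule_ge0// lee_fin.
rewrite -sumEFin; apply: eq_bigr => i _.
rewrite ge0_integralZl_EFin//; last exact: mI.
rewrite integral_indic// setIT EFinM; congr (_ * _)%E.
by rewrite /= /prob_fun asboolT// fineK// fin_num_measure.
Qed.

Lemma step_sum_posneg m (I : finType) (p : T -> I) (a : I -> R) :
  step_sum m p (fun i => Num.max (a i) 0) -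
  step_sum m p (fun i => Num.max (- a i) 0) = step_sum (m : ba T R) p a.
Proof.
rewrite -[X in _ - X]mul1r -mulNr -step_sumZ -step_sumD.
apply: eq_bigr => i _; congr (_ * _); rewrite !maxElt.
by case: (ltP (a i) 0); case: (ltP (- a i) 0); lra.
Qed.

Lemma integral_step_funepos P (I : finType) (p : T -> I) (a : I -> R) :
  fiber_measurable p ->
  (\int[P]_x ((fun x => (a (p x))%:E)^\+ x) =
    (step_sum (prob_ba P) p (fun i => Num.max (a i) 0))%:E)%E.
Proof.
move=> mp; rewrite -ge0_integral_step//; last by move=> i;
  rewrite le_max lexx orbT.
by apply: eq_integral => x _; rewrite funeposE EFin_max.
Qed.

Lemma integral_step_funeneg P (I : finType) (p : T -> I) (a : I -> R) :
  fiber_measurable p ->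
  (\int[P]_x ((fun x => (a (p x))%:E)^\- x) =
    (step_sum (prob_ba P) p (fun i => Num.max (- a i) 0))%:E)%E.
Proof.
move=> mp; rewrite -ge0_integral_step//; last by move=> i;
  rewrite le_max lexx orbT.
by apply: eq_integral => x _; rewrite funenegE EFin_max.
Qed.

Lemma expected_log_step Q (I : finType) (p : T -> I) (a : I -> R) :
  fiber_measurable p ->
  expected_log Q (fun x => (expR (a (p x)))%:E) = (step_sum (prob_ba Q) p a)%:E.
Proof.
move=> mp; rewrite /expected_log.
rewrite [X in (X^\-)%E](_ : _ = fun x => (a (p x))%:E); last first.
  by apply/funext => x; rewrite lne_EFin ?expR_gt0// expRK.
rewrite [X in (X^\+)%E](_ : _ = fun x => (a (p x))%:E); last first.
  by apply/funext => x; rewrite lne_EFin ?expR_gt0// expRK.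
by rewrite integral_step_funeneg// ltry integral_step_funepos// -EFinB
  step_sum_posneg.
Qed.

Lemma measurable_lne_comp (f : T -> R) : measurable_fun [set: T] f ->
  measurable_fun [set: T] (fun x => lne (f x)%:E).
Proof.
move=> mf; apply: measurable_fun_ifT => //=.
  by apply: measurable_fun_ler.
by apply/measurable_EFinP; apply: measurableT_comp => //; exact: measurable_ln.
Qed.

(** Comparison of the positive and the negative parts separately, as these
    are what the expectation of log X is made of. *)
Lemma expected_log_le Q (X : T -> \bar R) (f : T -> R) (I : finType)
    (p : T -> I) (a : I -> R) : fiber_measurable p ->
  measurable_fun [set: T] f -> (forall x, X x = (f x)%:E) ->
  (forall x, lne (X x) <= (a (p x))%:E)%E ->
  (expected_log Q X <= (step_sum (prob_ba Q) p a)%:E)%E.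
Proof.
move=> mp mf XE Xa; rewrite /expected_log; case: ifPn => [Xoo|_];
  last exact: leNye.
have mL : measurable_fun [set: T] (fun x => lne (X x)).
  by under eq_fun do rewrite XE; exact: measurable_lne_comp.
have mA := measurable_step a mp.
rewrite -step_sum_posneg EFinB -integral_step_funepos//
  -integral_step_funeneg//.
apply: leeB; apply: ge0_le_integral => //.
- exact: measurable_funepos.
- exact: measurable_funepos.
- by move=> x _; apply: (@funepos_le _ _ setT) => //; rewrite inE.
- exact: measurable_funeneg.
- exact: measurable_funeneg.
- by move=> x _; apply: (@funeneg_le _ _ setT) => //; rewrite inE.
Qed.

End Expectations.

(** * Duality *)

Section Duality.
Local Open Scope ring_scope.
Context {d : measure_display} {T : measurableType d} {R : realType}.
Implicit Types (P Q : probability T R) (PP QQ : set (probability T R)).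
Implicit Types (mu nu : ba T R).

Notation W := (@wstar_ba d T R).

Lemma bounded_evariable_fine PP (X : T -> \bar R) : bounded_evariable PP X ->
  exists f : T -> R, exists B : R, [/\ measurable_fun [set: T] f,
    forall x, X x = (f x)%:E & forall x, 0 <= f x <= B].
Proof.
move=> [[mX X0 _] Xoo].
have XS x : (X x <= ereal_sup (range X))%E by apply: ereal_sup_ubound; exists x.
have Xfin x : X x \is a fin_num.
  by rewrite ge0_fin_numE//; exact: le_lt_trans (XS x) Xoo.
exists (fine \o X), (fine (ereal_sup (range X))); split.
- by apply: measurableT_comp mX; exact: fine_measurable.
- by move=> x; rewrite /= fineK.
- move=> x; rewrite fine_ge0//= fine_le//.
  by rewrite ge0_fin_numE//; exact: le_trans (X0 x) (XS x).
Qed.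

(** In general log X is not in B_b, being unbounded below or even -oo
    somewhere. It is replaced by b o p, where X < e^(b o p) <= X + e. *)
Lemma weak_duality PP QQ (X : T -> \bar R) nu mu : QQ !=set0 ->
  bounded_evariable PP X ->
  wstar_cco (prob_ba @` QQ) nu -> wstar_cco (prob_ba @` PP) mu ->
  (ereal_inf [set expected_log Q X | Q in QQ] <= relative_entropy nu mu)%E.
Proof.
move=> [Q0 QQ0] bX cnu cmu; have [f [B [mf XE fB]]] :=
  bounded_evariable_fine bX.
have [[_ X0 XP] _] := bX.
apply/lee_addgt0Pr => e e0; have e2 : 0 < e / 2 by rewrite divr_gt0.
(* The shift by e / 2 makes a positive on the range of p. *)
have [||I [p [a [mp pa]]]] :=
  @step_approximation _ _ _ (fun x => f x + e / 2) (B + e / 2) (e / 2) _ _ e2.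
- by apply: measurable_funD.
- by move=> x; have := fB x; rewrite ler_norml; lra.
pose b i := ln (a i).
have a0 x : 0 < a (p x) by have := pa x; have := fB x; lra.
have Xb x : (lne (X x) <= (b (p x))%:E)%E.
  rewrite XE /=; case: ifPn => [_|]; first exact: leNye.
  rewrite -ltNge => f0; rewrite lee_fin ler_ln ?posrE//.
  by have := pa x; lra.
have Eb Q : (expected_log Q X <= (step_sum (prob_ba Q) p b)%:E)%E.
  exact: expected_log_le XE Xb.
have mub : step_sum mu p (expR \o b) <= 1 + e.
  apply: wstar_cco_halfspace_le cmu => // _ [P PPP <-].
  rewrite -lee_fin -ge0_integral_step//; last by move=> i; exact: expR_ge0.
  apply: (@le_trans _ _ (\int[P]_x (X x + cst e%:E x))%E).
    apply: ge0_le_integral => //.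
    - by move=> x _; rewrite lee_fin expR_ge0.
    - exact: measurable_step.
    - by apply: emeasurable_funD => //; case: bX => -[].
    - move=> x _; rewrite XE -EFinD lee_fin /= /b lnK ?posrE//.
      by have := pa x; lra.
  rewrite ge0_integralD//; last 2 first.
  - by case: bX => -[].
  - by move=> x _; rewrite lee_fin ltW.
  rewrite integral_cst// [X in (_ * X)%E]probability_setT mule1 EFinD.
  by apply: leeD => //; exact: XP.
set E := ereal_inf _.
have EQ Q : QQ Q -> (E <= (step_sum (prob_ba Q) p b)%:E)%E.
  move=> QQQ; apply: le_trans (Eb Q); apply: ereal_inf_lbound.
  by exists Q.
move: E EQ => [r EQ|/(_ Q0 QQ0)//|_]; last exact: leNye.
have rnu : r <= step_sum nu p b.
  by apply: wstar_cco_halfspace cnu => // _ [Q QQQ <-]; rewrite -lee_fin EQ.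
rewrite -leeBlDr// -EFinB.
apply: le_trans (donsker_varadhan_le b mp (wstar_cco_prob cnu) (wstar_cco_prob
  cmu)).
by rewrite lee_fin /donsker_varadhan; lra.
Qed.

Definition dv_family : set (W * W -> R) := [set phi |
  exists (I : finType) (p : T -> I) (a : I -> R), fiber_measurable p /\
    phi = fun z => donsker_varadhan z.1 z.2 p a].

Lemma dv_family_continuous phi : dv_family phi -> continuous phi.
Proof.
move=> [I [p [a [mp ->]]]] z; rewrite /donsker_varadhan.
apply: cvgD; last exact: cvg_cst.
apply: cvgB.
  apply: (@cvg_comp _ _ _ fst (fun m : W =>
    step_sum m p a : R) _ (nbhs (z.1 : W))).
    exact: cvg_fst.
  exact: step_sum_continuous.
apply: (@cvg_comp _ _ _ snd (fun m : W => step_sum m p (expR \o a) : R) _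
  (nbhs (z.2 : W))).
  exact: cvg_snd.
exact: step_sum_continuous.
Qed.

Lemma donsker_varadhan_continuousr nu (I : finType) (p : T -> I) (a : I -> R) :
  fiber_measurable p ->
  continuous (fun mu : W => donsker_varadhan nu mu p a : R).
Proof.
move=> mp mu; rewrite /donsker_varadhan.
have cmu := @step_sum_continuous _ _ R _ p (expR \o a) mp mu.
have FF : Filter (nbhs (mu : W)) by exact: nbhs_filter.
have cst_cvg (c : R) : (cst c : W -> R) @ mu --> c by exact: cvg_cst.
exact: (cvgD (cvgB (cst_cvg _) cmu) (cst_cvg 1)).
Qed.

Lemma dv_family_convexlike (A B : set (ba T R)) :
  convexlike dv_family [set z : W * W | co A z.1 /\ co B z.2].
Proof.
move=> x y t [Ax Bx] [Ay By] t01.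
exists (t *: (x.1 : ba T R) + (1 - t) *: (y.1 : ba T R),
  t *: (x.2 : ba T R) + (1 - t) *: (y.2 : ba T R)).
  by split => /=; exact: co_convex.
move=> _ [I [p [a [mp ->]]]]; rewrite /donsker_varadhan /= !step_sum_comb; lra.
Qed.

(** Both functions are rewritten over the common refinement of their
    partitions; then the exponential is convex and mu is nonnegative. *)
Lemma dv_family_concavelike PP QQ : concavelike dv_family
  [set z : W * W | co (prob_ba @` QQ) z.1 /\ co (prob_ba @` PP) z.2].
Proof.
move=> _ _ t [I [p [a [mp ->]]]] [J [q [b [mq ->]]]] /andP[t0 t1].
have mpq := fiber_measurable_pair mp mq.
pose pq x := (p x, q x).
exists (fun z => donsker_varadhan z.1 z.2 pq
  (fun i => t * a i.1 + (1 - t) * b i.2)).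
  by exists (I * J)%type, pq, (fun i => t * a i.1 + (1 - t) * b i.2).
move=> [nu mu] [_ /= /co_sub_wstar_cco/wstar_cco_prob[mu0 _]].
rewrite /donsker_varadhan step_sumD !step_sumZ.
have pE m u : step_sum m p u = step_sum m pq (u \o fst).
  by rewrite -(step_sum_comp m fst u mpq).
have qE m u : step_sum m q u = step_sum m pq (u \o snd).
  by rewrite -(step_sum_comp m snd u mpq).
rewrite !pE !qE.
suff : step_sum mu pq (expR \o (fun i => t * a i.1 + (1 - t) * b i.2)) <=
    t * step_sum mu pq ((expR \o a) \o fst) +
    (1 - t) * step_sum mu pq ((expR \o b) \o snd) by lra.
rewrite -!step_sumZ -step_sumD; apply: ler_sum => i _; apply: ler_wpM2r => //=.
exact: (convex_expR (Itv01 t0 t1)).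
Qed.

(** Compactness and lower semicontinuity: with nu fixed, H(nu | mu) is a
    supremum of continuous functions of mu. *)
Lemma relative_entropy_min_right PP nu : PP !=set0 -> ba_prob nu ->
  exists2 mu, wstar_cco (prob_ba @` PP) mu & relative_entropy nu mu =
    ereal_inf [set relative_entropy nu m | m in wstar_cco (prob_ba @` PP)].
Proof.
move=> PP0 nuP; pose F : set (W -> R) := [set phi |
  exists (I : finType) (p : T -> I) (a : I -> R), fiber_measurable p /\
    phi = fun mu => donsker_varadhan nu mu p a].
apply: (@compact_attains_inf R W _ F (relative_entropy nu)).
- exact: wstar_cco_compact.
- exact: wstar_cco_nonempty.
- by move=> _ [I [p [a [mp ->]]]]; exact: donsker_varadhan_continuousr.
- move=> _ mu [I [p [a [mp ->]]]] cmu.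
  by apply: donsker_varadhan_le => //; exact: wstar_cco_prob cmu.
- move=> mu c cmu cH; have [I [p [a [mp ca]]]] :=
    donsker_varadhan_approx nuP (wstar_cco_prob cmu) cH.
  by exists (fun mu => donsker_varadhan nu mu p a) => //; exists I, p, a.
Qed.

Lemma relative_entropy_min_joint PP QQ : PP !=set0 -> QQ !=set0 ->
  exists nu mu, [/\ wstar_cco (prob_ba @` QQ) nu, wstar_cco (prob_ba @` PP) mu
    & forall nu' mu', wstar_cco (prob_ba @` QQ) nu' ->
        wstar_cco (prob_ba @` PP) mu' ->
        (relative_entropy nu mu <= relative_entropy nu' mu')%E].
Proof.
move=> PP0 QQ0; pose H (z : W * W) := relative_entropy z.1 z.2.
pose K : set (W * W) := wstar_cco (prob_ba @` QQ) `*` wstar_cco (prob_ba @` PP).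
have [[nu mu] [/= cnu cmu] Hmin] : exists2 z, K z & H z = ereal_inf (H @` K).
  apply: (@compact_attains_inf _ _ _ dv_family).
  - by apply: compact_setX; exact: wstar_cco_compact.
  - have [mu cmu] := wstar_cco_nonempty PP0.
    by have [nu cnu] := wstar_cco_nonempty QQ0; exists (nu, mu).
  - exact: dv_family_continuous.
  - move=> _ [nu mu] [I [p [a [mp ->]]]] [/= cnu cmu].
    by apply: donsker_varadhan_le => //; apply: wstar_cco_prob; eassumption.
  - move=> [nu mu] c [/= cnu cmu] cH.
    have [I [p [a [mp ca]]]] :=
      donsker_varadhan_approx (wstar_cco_prob cnu) (wstar_cco_prob cmu) cH.
    by exists (fun z => donsker_varadhan z.1 z.2 p a) => //; exists I, p, a.
exists nu, mu; split=> // nu' mu' cnu' cmu'.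
rewrite -[leLHS]/(H (nu, mu)) Hmin; apply: ereal_inf_lbound.
by exists (nu', mu').
Qed.

(** The e-variable is X = e^(f + 1 - c) with c = sup_P E_P[e^f]. The exact
    normalisation would be e^f / c; replacing ln c by its tangent c - 1 loses
    nothing, since the level w is reached by nu(f) - mu(e^f) + 1, in which
    mu(e^f) enters linearly. *)
Lemma strong_duality PP QQ (v w : R) : PP !=set0 -> QQ !=set0 ->
  w < v ->
  (forall nu mu, wstar_cco (prob_ba @` QQ) nu -> wstar_cco (prob_ba @` PP) mu ->
    (v%:E < relative_entropy nu mu)%E) ->
  exists2 X : T -> \bar R, bounded_evariable PP X &
    forall Q, QQ Q -> (w%:E <= expected_log Q X)%E.
Proof.
move=> [P0 PP0] [Q0 QQ0] wv vH.
have cK := compact_setX (@wstar_cco_compact _ T R QQ) (@wstar_cco_compact _ T R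
  PP).
have [|s sF sK] := compact_finite_family cK dv_family_continuous (v := v).
  move=> [nu mu] [/= cnu cmu].
  have [I [p [a [mp va]]]] := donsker_varadhan_approx (wstar_cco_prob cnu)
    (wstar_cco_prob cmu) (vH _ _ cnu cmu).
  by exists (fun z => donsker_varadhan z.1 z.2 p a) => //; exists I, p, a.
have [||_ [I [p [a [mp ->]]]] aw] :=
  finite_minimax _ (@dv_family_convexlike _ _)
  (@dv_family_concavelike PP QQ) sF _ wv.
- exists (fun z => donsker_varadhan z.1 z.2 (fun=> tt) (fun=> 0)).
  exists unit, (fun=> tt), (fun=> 0); split=> // -[].
  by rewrite (_ : _ @^-1` _ = [set: T])//; apply/seteqP; split.
- move=> [nu mu] [/= cnu cmu]; have [|f fs vf] := sK (nu, mu).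
    by split; exact: co_sub_wstar_cco.
  by exists f => //; exact: ltW.
have {}aw Q P : QQ Q -> PP P ->
    w <= step_sum (prob_ba Q) p a - step_sum (prob_ba P) p (expR \o a) + 1.
  move=> QQQ PPP; apply: (aw (prob_ba Q, prob_ba P)); split.
    by apply: sub_gen_smallest; exists Q.
  by apply: sub_gen_smallest; exists P.
pose S := [set step_sum (prob_ba P) p (expR \o a) | P in PP].
have Sub Q : QQ Q -> ubound S (step_sum (prob_ba Q) p a - w + 1).
  by move=> QQQ _ [P PPP <-]; have := aw Q P QQQ PPP; lra.
have S0 : S !=set0 by exists (step_sum (prob_ba P0) p (expR \o a)), P0.
have supS : has_sup S by split=> //;
  exists (step_sum (prob_ba Q0) p a - w + 1); exact: Sub.
pose c := sup S; pose b i := a i + (1 - c).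
exists (fun x => (expR (b (p x)))%:E) => [|Q QQQ]; last first.
  rewrite expected_log_step// lee_fin step_sumD step_sum_cst// prob_baT.
  by have : c <= step_sum (prob_ba Q) p a - w + 1 by [apply: ge_sup => //;
    exact: Sub]; lra.
split; last first.
  apply: (@le_lt_trans _ _ (\sum_i expR (b i))%:E); last exact: ltry.
  apply: ge_ereal_sup => _ [x _ <-]; rewrite lee_fin (bigD1 (p x))//= lerDl.
  by apply: sumr_ge0 => i _; exact: expR_ge0.
split=> [|x|P PPP].
- exact: (measurable_step (expR \o b)).
- by rewrite lee_fin expR_ge0.
rewrite (ge0_integral_step P (a := expR \o b))//; last by move=> i;
  exact: expR_ge0.
rewrite (_ : expR \o b = fun i => expR (1 - c) * (expR \o a) i); last first.
  by apply/funext => i; rewrite /= expRD mulrC.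
rewrite step_sumZ lee_fin -opprB expRN mulrC ler_pdivrMr ?expR_gt0// mul1r.
apply: (@le_trans _ _ c).
  by apply: ub_le_sup; [case: supS|exists P].
by have := expR_ge1Dx (c - 1); lra.
Qed.

End Duality.

Theorem theorem3p1 (R : realType) (d : measure_display) (T : measurableType d)
    (PP QQ : set (probability T R)) (PP0 : PP !=set0) (QQ0 : QQ !=set0) :
  let coP := wstar_cco (prob_ba @` PP) in
  let coQ := wstar_cco (prob_ba @` QQ) in
  let entropies nu := [set relative_entropy nu mu | mu in coP] in
  let min_entropies := [set ereal_inf (entropies nu) | nu in coQ] in
  [/\ ereal_sup [set ereal_inf [set expected_log Q X | Q in QQ]
                | X in bounded_evariable PP]
      = ereal_inf min_entropies,
      forall nu, coQ nu -> attains_inf (entropies nu),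
      attains_inf min_entropies
    & exists mu_star nu_star,
        [/\ coP mu_star, coQ nu_star
          & relative_entropy nu_star mu_star = ereal_inf min_entropies]].
Proof.
move=> coP coQ entropies min_entropies.
have [nu [mu [cnu cmu numin]]] := relative_entropy_min_joint PP0 QQ0.
have min_le nu' mu' : coQ nu' -> coP mu' ->
    (ereal_inf min_entropies <= relative_entropy nu' mu')%E.
  move=> cnu' cmu'; apply: (@le_trans _ _ (ereal_inf (entropies nu'))).
    by apply: ereal_inf_lbound; exists nu'.
  by apply: ereal_inf_lbound; exists mu'.
have minE : relative_entropy nu mu = ereal_inf min_entropies.
  apply/eqP; rewrite eq_le min_le// andbT.
  apply: le_ereal_inf_tmp => _ [nu' cnu' <-].
  by apply: le_ereal_inf_tmp => _ [mu' cmu' <-]; exact: numin.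
split.
- apply/eqP; rewrite eq_le; apply/andP; split.
    apply: ge_ereal_sup => _ [X bX <-]; rewrite -minE.
    exact: weak_duality bX cnu cmu.
  rewrite leNgt; apply/negP => /ereal_between[w [sw wm]].
  have [v [+ vm]] := ereal_between wm; rewrite lte_fin => wv.
  have [|X bX Xw] := @strong_duality _ _ _ PP QQ v w PP0 QQ0 wv.
    by move=> nu' mu' cnu' cmu'; exact: lt_le_trans vm (min_le _ _ cnu' cmu').
  move: sw; rewrite ltNge => /negP; apply.
  apply: (@le_trans _ _ (ereal_inf [set expected_log Q X | Q in QQ])).
    by apply: le_ereal_inf_tmp => _ [Q QQQ <-]; exact: Xw.
  by apply: ereal_sup_ubound; exists X.
- move=> nu' cnu'; exact: relative_entropy_min_right (wstar_cco_prob cnu').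
- exists nu => //; apply/eqP; rewrite eq_le; apply/andP; split.
    by rewrite -minE; apply: ereal_inf_lbound; exists mu.
  by apply: ereal_inf_lbound; exists nu.
- by exists mu, nu.
Qed.
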